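(* Let $s\geq t\geq 2$ be integers, and let $G$ be a $K_{s,t}$-free graph of order $n$ and spectral radius $\mu$. If $t=2$, then $$\mu\leq \frac12+\sqrt{(s-1)(n-1)+\frac14}.$$ If $t\geq 3$, then $$\mu\leq (s-t+1)^{1/t}n^{1-1/t}+(t-1)n^{1-2/t}+t-2.$$
   Context: Graphs are finite, simple and undirected. The order of a graph is its number of vertices. The spectral radius of $G$ is the spectral radius (equivalently, the largest eigenvalue) of its adjacency matrix. $K_{s,t}$ denotes the complete bipartite graph with vertex classes of sizes $s$ and $t$. A graph is $K_{s,t}$-free if it does not contain $K_{s,t}$ as a (not necessarily induced) subgraph. *)

(* Defs.v *)
From HB Require Import structures.
From mathcomp Require Import all_boot all_order all_algebra.
From mathcomp Require Import complex.
From mathcomp Require Import all_classical all_reals all_analysis.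

Set Implicit Arguments.
Unset Strict Implicit.
Unset Printing Implicit Defensive.

Import Order.TTheory GRing.Theory Num.Theory.

Local Open Scope classical_set_scope.
Local Open Scope ring_scope.
Local Open Scope complex_scope.

Record sgraph := SGraph {
  vertex :> finType;
  adj : rel vertex;
  adj_sym : symmetric adj;
  adj_irr : irreflexive adj
}.

Definition order (G : sgraph) : nat := #|G|.

(* Not necessarily induced: non-edges of H may be mapped to edges of G. *)
Definition subgraph (H G : sgraph) : Prop :=
  exists f : H -> G,
    injective f /\ (forall x y : H, adj x y -> adj (f x) (f y)).

Section CompleteBipartite.
Variables s t : nat.

Definition Kbip_adj : rel ('I_s + 'I_t)%type :=
  fun x y => match x, y with
             | inl _, inr _ | inr _, inl _ => true
             | _, _ => false
             end.

Fact Kbip_sym : symmetric Kbip_adj. Proof. by case=> ? []. Qed.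

Fact Kbip_irr : irreflexive Kbip_adj. Proof. by case. Qed.

Definition Kbip : sgraph := SGraph Kbip_sym Kbip_irr.

End CompleteBipartite.

Definition Kfree (s t : nat) (G : sgraph) : Prop := ~ subgraph (Kbip s t) G.

Definition adjmx (R : realType) (G : sgraph) : 'M[R]_(order G) :=
  \matrix_(i, j) (adj (enum_val i : G) (enum_val j : G))%:R.

Definition eigenvalue_moduli (R : realType) (m : nat) (A : 'M[R]_m) : set R :=
  [set Normc.normc z | z in
     [set z : R[i] | eigenvalue (map_mx (real_complex R) A) z]].

(* For m > 0 the set is finite and nonempty, so sup is its maximum; for m = 0
   it is empty and the value is 0. *)
Definition spectral_radius (R : realType) (m : nat) (A : 'M[R]_m) : R :=
  sup (eigenvalue_moduli A).

(* Main.v *)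
Require Import Defs.
From mathcomp Require Import all_boot all_order all_algebra.
From mathcomp Require Import all_classical all_reals all_analysis.
From mathcomp Require Import fintype finset complex ring lra.

Import Order.TTheory GRing.Theory Num.Theory.

Local Open Scope ring_scope.

(** The largest eigenvalue is controlled by counting walks of length two.  Let
    d(u) be the degree of u and let W(u) be the number of walks of length two
    from u, which is the sum over all vertices v of the number of common
    neighbours of u and v.  If W(u) <= al * d(u) + be for every vertex u, then
    every eigenvalue of modulus x satisfies x^2 <= al * x + be
    ([eigenvalue_sqr_le]): weight the vertices by the moduli of the entries of
    an eigenvector.  The term v = u contributes exactly d(u) to W(u), so the
    task is to bound the codegrees of u with the other vertices
    ([spectral_radius_codegree]).

    In a K_{s,t}-free graph any t vertices have at most s - 1 common neighbours
    ([Kfree_common_nbhd]).  For t = 2 every codegree is at most s - 1, so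
    x^2 <= x + (s - 1)(n - 1), which is the first bound.

    For t >= 3 consider the traces N(v) :&: N(u), for v different from u, on the
    set N(u).  A t-subset of N(u) has u as a common neighbour, so at most s - 2
    of these traces contain it: this is a Zarankiewicz problem with N(u) as one
    of the sides.  The lemma [zarankiewicz] solves it by induction on k, where
    q + k bounds the number of members of a set family that contain a given
    t-set.  The base case is the double count of Kovari, Sos and Turan together
    with the power mean inequality.  The inductive step passes to the traces on
    one member v, where v itself no longer counts, so that k drops by one; this
    bounds the sum of |N(v) :&: N(w)| over all pairs, hence the sum of squares
    of the degrees of the points, and Cauchy-Schwarz turns this into a quadratic
    inequality for the total size of the family.  With q = s - t + 1 and
    k = t - 3 the resulting bound is linear in d(u), with

      al = (s - t + 1)^(1/t) n^(1 - 1/t) + t - 2,   be = (t - 1) n^(2 - 3/t).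

    Both the inductive step and the final passage to the eigenvalue solve their
    quadratic inequality by [le_of_sqr_le].  All fractional powers are integral
    powers of a = n^(1/t) and b = (s - t + 1)^(1/t), and only a and b occur
    until the last proof. *)

(** * Real inequalities *)

(** The convex function y^(p+1) lies above its tangent at z, with denominators
    and subtractions cleared. *)
Lemma tangent_pow (R : realFieldType) (y z : R) (p : nat) :
  0 <= y -> 0 <= z -> p.+1%:R * y * z ^+ p <= y ^+ p.+1 + p%:R * z ^+ p.+1.
Proof.
move=> y0 z0; elim: p => [|p IHp]; first by rewrite mul1r expr0 mulr1 mul0r addr0.
rewrite -subr_ge0.
have -> : y ^+ p.+2 + p.+1%:R * z ^+ p.+2 - p.+2%:R * y * z ^+ p.+1 =
    y * (y ^+ p.+1 + p%:R * z ^+ p.+1 - p.+1%:R * y * z ^+ p)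
    + p.+1%:R * z ^+ p * (z - y) ^+ 2.
  rewrite !mulrS !exprS; move: (z ^+ p) (y ^+ p) (p%:R : R) => a b c; ring.
apply: addr_ge0; first by rewrite mulr_ge0 ?subr_ge0.
by rewrite mulr_ge0 ?sqr_ge0 // mulr_ge0 ?ler0n ?exprn_ge0.
Qed.

(** Sum the tangent inequality at the mean z of the y i: the linear terms
    cancel. *)
Lemma power_mean (R : realFieldType) (I : finType) (C : {set I}) (y : I -> R)
    (p : nat) :
  (forall i, 0 <= y i) ->
  (\sum_(i in C) y i) ^+ p.+1 <= #|C|%:R ^+ p * \sum_(i in C) y i ^+ p.+1.
Proof.
move=> y0; have [->|/set0Pn[i0 i0C]] := eqVneq C set0.
  by rewrite !big_set0 expr0n mulr0.
set S := \sum_(i in C) y i; set n : R := #|C|%:R.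
have n0 : 0 < n by rewrite ltr0n card_gt0; apply/set0Pn; exists i0.
pose z := S / n.
have S0 : 0 <= S by apply: sumr_ge0.
have z0 : 0 <= z by rewrite divr_ge0 // ltW.
have SE : S = n * z by rewrite /z mulrCA mulfV ?mulr1 ?lt0r_neq0.
have key : n * z ^+ p.+1 <= \sum_(i in C) y i ^+ p.+1.
  have : \sum_(i in C) (p.+1%:R * y i * z ^+ p)
      <= \sum_(i in C) (y i ^+ p.+1 + p%:R * z ^+ p.+1).
    by apply: ler_sum => i _; apply: tangent_pow.
  rewrite big_split /= sumr_const -mulr_suml -mulr_sumr -/S SE -[_ *+ #|C|]mulr_natl -/n.
  rewrite -natr1 exprS => h; lra.
rewrite SE exprMn exprSr -mulrA ler_wpM2l // exprn_ge0 // ltW //.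
Qed.

(** If x > P + Q, then also x > M, so x^2 > P * x + Q * x >= P * x + Q * M.  This
    replaces the exact root of the quadratic, whose square root would spoil the
    shape of the bounds. *)
Lemma le_of_sqr_le (R : realFieldType) (x P Q M : R) :
  0 <= M -> M <= P -> 0 <= Q -> x ^+ 2 <= P * x + Q * M -> x <= P + Q.
Proof.
move=> M0 MP Q0 h; rewrite leNgt; apply/negP => hx.
have : 0 < (x - P - Q) * x by rewrite mulr_gt0; nra.
by have : Q * M <= Q * x; [rewrite ler_wpM2l; lra | nra].
Qed.

(** Together with [ffact_exp] this compares binomial coefficients with powers.
    The truncated subtraction makes it true also for n <= p. *)
Lemma exp_subn_ffact (n p : nat) : ((n - p) ^ p.+1 <= n ^_ p.+1)%N.
Proof.
elim: p n => [|p IHp] [|n]; rewrite ?sub0n ?exp0n // ?subn0 ?ffactn1 //.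
by rewrite subSS expnS ffactSS leq_mul // leqW // leq_subr.
Qed.

Lemma ffact_exp (n p : nat) : (n ^_ p <= n ^ p)%N.
Proof.
elim: p n => [|p IHp] n; first by rewrite ffactn0.
rewrite expnS; case: n => [|n] //.
rewrite ffactSS leq_mul // (leq_trans (IHp n)) //.
by case: p {IHp} => // p; rewrite leq_exp2r.
Qed.

(** * Set families in which few members contain a given t-set *)

Section SetFamily.
Variables (V T : finType) (N : V -> {set T}).

(** Count in two ways the pairs (v, S) with v in C and S a t-subset of both
    N v and X. *)
Lemma sum_bin_inter (t q : nat) (C : {set V}) (X : {set T}) :
  (forall S : {set T}, S \subset X -> #|S| = t ->
     (#|[set v in C | S \subset N v]| <= q)%N) ->
  (\sum_(v in C) 'C(#|N v :&: X|, t) <= q * 'C(#|X|, t))%N.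
Proof.
move=> hq.
under eq_bigr => v _ do rewrite -cards_draws -sum1dep_card.
rewrite (exchange_big_dep (fun S : {set T} => (S \subset X) && (#|S| == t))) /=; last first.
  by move=> v S _; rewrite subsetI => /andP[/andP[_ ->] ->].
rewrite -(cards_draws X) -sum1dep_card big_distrr /=.
apply: leq_sum => S /andP[SX /eqP St].
rewrite muln1; apply: leq_trans (hq S SX St); rewrite sum1dep_card.
apply/subset_leq_card/subsetP => v; rewrite !inE subsetI.
by case/andP=> -> /andP[/andP[-> _] _].
Qed.

(** Both sides count the triples (v, w, x) with x in X, N v and N w.  The set
    X :&: N v is kept together because it is the ground set of the family of
    traces on N v. *)
Lemma sum_sqr_degrees (C : {set V}) (X : {set T}) :
  (\sum_(v in C) \sum_(w in C) #|N w :&: (X :&: N v)|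
   = \sum_(x in X) #|[set v in C | x \in N v]| ^ 2)%N.
Proof.
under eq_bigr => v _ do under eq_bigr => w _ do rewrite -sum1_card big_mkcond /=.
under [RHS]eq_bigr => x _ do rewrite -sum1dep_card -mulnn big_distrlr /=.
under eq_bigr => v _ do rewrite exchange_big /=.
rewrite exchange_big /= [RHS]big_mkcond /=; apply: eq_bigr => x _.
case: ifP => xX; last first.
  by rewrite big1 // => v _; rewrite big1 // => w _; rewrite !inE xX andbF.
rewrite (bigID (fun v => x \in N v)) /= [X in (_ + X)%N]big1 ?addn0; last first.
  by move=> v /andP[_ /negbTE xv]; rewrite big1 // => w _; rewrite !inE xv !andbF.
apply: eq_big => [v|v /andP[_ xv]]; first by [].
rewrite [RHS]big_mkcondr /=; apply: eq_bigr => w _.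
by rewrite !inE xX xv !andbT.
Qed.

Lemma sum_degrees (C : {set V}) (X : {set T}) :
  (\sum_(v in C) #|N v :&: X| = \sum_(x in X) #|[set v in C | x \in N v]|)%N.
Proof.
under eq_bigr => v _ do rewrite -sum1_card big_mkcond /=.
under [RHS]eq_bigr => x _ do rewrite -sum1dep_card big_mkcondr /=.
rewrite exchange_big /= [RHS]big_mkcond /=; apply: eq_bigr => x _.
case: ifP => xX; last by rewrite big1 // => v _; rewrite !inE xX andbF.
by apply: eq_bigr => v _; rewrite !inE xX andbT.
Qed.

(** Nikiforov's bound for the Zarankiewicz problem, with t = p + 1.  Here a
    bounds the t-th root of the number of members of the family, and b the t-th
    root of q. *)
Lemma zarankiewicz (R : realFieldType) (p k q : nat) (a b : R)
    (C : {set V}) (X : {set T}) :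
  0 <= a -> 1 <= b -> q%:R <= b ^+ p.+1 -> #|C|%:R <= a ^+ p.+1 ->
  (forall S : {set T}, S \subset X -> #|S| = p.+1 ->
     (#|[set v in C | S \subset N v]| <= q + k)%N) ->
  \sum_(v in C) #|N v :&: X|%:R
    <= (b * a ^+ p + k%:R) * #|X|%:R + p%:R * a ^+ (p.+1 + k).
Proof.
move=> a0 b1 qb; have b0 : 0 <= b by lra.
elim: k C X => [|k IHk] C X Ca hfree.
  (* The double count of Kovari, Sos and Turan. *)
  have hbin := sum_bin_inter p.+1 q C X (fun S SX St => leq_trans (hfree S SX St) (eq_leq (addn0 q))).
  have hnat : (\sum_(v in C) (#|N v :&: X| - p) ^ p.+1 <= q * #|X| ^ p.+1)%N.
    apply: leq_trans (leq_mul (leqnn q) (ffact_exp _ _)).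
    rewrite -bin_ffact mulnA; apply: leq_trans (leq_mul hbin (leqnn _)).
    rewrite big_distrl /=; apply: leq_sum => v _.
    by rewrite bin_ffact exp_subn_ffact.
  (* Each member is charged its excess over p; the rest costs p per member. *)
  set y : V -> R := fun v => (#|N v :&: X| - p)%:R.
  have hy : \sum_(v in C) y v <= b * a ^+ p * #|X|%:R.
    rewrite -(@ler_pXn2r _ p.+1) // ?nnegrE ?sumr_ge0 ?mulr_ge0 ?exprn_ge0 //.
    apply: le_trans (power_mean _ _ C y p _) _; first by move=> v; rewrite /y ler0n.
    have -> : (b * a ^+ p * #|X|%:R) ^+ p.+1
        = (a ^+ p.+1) ^+ p * (b ^+ p.+1 * #|X|%:R ^+ p.+1).
      by rewrite !exprMn -!exprM [(p.+1 * p)%N]mulnC; ring.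
    apply: ler_pM; first by rewrite exprn_ge0.
    - by apply: sumr_ge0 => v _; rewrite exprn_ge0.
    - by rewrite lerXn2r ?nnegrE ?exprn_ge0.
    apply: (@le_trans _ _ (q%:R * #|X|%:R ^+ p.+1)); last first.
      by rewrite ler_wpM2r ?exprn_ge0.
    move: hnat; rewrite -(ler_nat R) natrM natrX natr_sum.
    by under eq_bigr => v _ do rewrite natrX.
  apply: (@le_trans _ _ (\sum_(v in C) (y v + p%:R))).
    apply: ler_sum => v _; rewrite /y -natrD ler_nat addnC.
    by rewrite -leq_subLR.
  rewrite big_split /= sumr_const -[p%:R *+ _]mulr_natr addr0 addn0.
  by rewrite lerD // ler_wpM2l.
set e := \sum_(v in C) #|N v :&: X|%:R; set A := b * a ^+ p.
have A0 : 0 <= A by rewrite mulr_ge0 ?exprn_ge0.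
(* On the ground set X :&: N v every t-set lies in v, so the other members
   satisfy the hypothesis with k instead of k + 1. *)
have hrow v : v \in C -> \sum_(w in C) #|N w :&: (X :&: N v)|%:R
    <= (A + k.+1%:R) * #|N v :&: X|%:R + p%:R * a ^+ (p.+1 + k) :> R.
  move=> vC; rewrite (big_setD1 v) //= [N v :&: X]setIC setICA setIid.
  have hC : #|C| = #|C :\ v|.+1 by rewrite (cardsD1 v C) vC.
  have h : \sum_(w in C :\ v) #|N w :&: (X :&: N v)|%:R
      <= (A + k%:R) * #|X :&: N v|%:R + p%:R * a ^+ (p.+1 + k) :> R.
    apply: IHk => [|S].
      by apply: le_trans Ca; rewrite ler_nat hC.
    rewrite subsetI => /andP[SX Sv] St.
    have := hfree S SX St; rewrite addnS (cardsD1 v) !inE vC Sv /= ltnS.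
    apply: leq_trans; apply/subset_leq_card/subsetP => w.
    by rewrite !inE -andbA.
  by rewrite -natr1; lra.
(* Cauchy-Schwarz over the degrees of the points of X. *)
have hsq : e ^+ 2 <= #|X|%:R * (\sum_(v in C) \sum_(w in C) #|N w :&: (X :&: N v)|%:R).
  pose d x : R := #|[set v in C | x \in N v]|%:R.
  have -> : e = \sum_(x in X) d x by rewrite /e -natr_sum sum_degrees natr_sum.
  have -> : \sum_(v in C) \sum_(w in C) #|N w :&: (X :&: N v)|%:R
      = \sum_(x in X) d x ^+ 2.
    under eq_bigr => v _ do rewrite -natr_sum.
    rewrite -natr_sum sum_sqr_degrees natr_sum.
    by apply: eq_bigr => x _; rewrite natrX.
  by rewrite -[X in X * _]expr1; apply: (power_mean _ _ X d 1) => x; rewrite ler0n.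
(* Here Q * M = |X| * p * a^(2p + 2 + k), and M <= P because 1 <= b. *)
rewrite mulrC; apply: (@le_of_sqr_le _ _ _ _ (#|X|%:R * a ^+ p)).
- by rewrite mulr_ge0 ?exprn_ge0.
- rewrite ler_wpM2l // -[leLHS]mul1r -[leLHS]addr0.
  by rewrite lerD // ler_wpM2r ?exprn_ge0.
- by rewrite mulr_ge0 ?exprn_ge0.
apply: (le_trans hsq).
have hsum : \sum_(v in C) \sum_(w in C) #|N w :&: (X :&: N v)|%:R
    <= (A + k.+1%:R) * e + a ^+ p.+1 * (p%:R * a ^+ (p.+1 + k)).
  apply: le_trans (ler_sum _ hrow) _.
  rewrite big_split /= -mulr_sumr sumr_const -[_ *+ #|C|]mulr_natl lerD2l.
  by rewrite ler_wpM2r // mulr_ge0 ?exprn_ge0.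
apply: (le_trans (ler_wpM2l (ler0n R _) hsum)).
have -> : a ^+ p.+1 * (p%:R * a ^+ (p.+1 + k)) = p%:R * a ^+ (p.+1 + k.+1) * a ^+ p.
  by rewrite !exprD !exprS; ring.
lra.
Qed.

End SetFamily.

(** * Eigenvalues of nonnegative matrices *)

Lemma normc_ge0 (R : rcfType) (z : R[i]) : 0 <= Normc.normc z.
Proof. by case: z => x y; apply: sqrtr_ge0. Qed.

Lemma normc_nneg (R : rcfType) (x : R) :
  0 <= x -> Normc.normc (real_complex R x) = x.
Proof. by move=> x0; rewrite /= expr0n addr0 sqrtr_sqr ger0_norm. Qed.

Lemma normc_sum (R : rcfType) (I : finType) (f : I -> R[i]) :
  Normc.normc (\sum_i f i) <= \sum_i Normc.normc (f i).
Proof.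
elim/big_ind2: _ => [|x1 x2 y1 y2 h1 h2|//]; first by rewrite Normc.normc0.
exact: le_trans (le_normcD _ _) (lerD h1 h2).
Qed.

(** Let x be the vector of moduli of a left eigenvector, and r the vector of row
    sums of M.  The triangle inequality gives |z| x <= x M entrywise.  Summing
    the entries gives |z| X <= D, where X is the sum of x and D = x r; pairing
    with r gives |z| D <= x M r <= al * D + be * X.  The two combine without the
    Perron-Frobenius theorem. *)
Lemma eigenvalue_sqr_le (R : rcfType) (m : nat) (M : 'M[R]_m) (al be : R)
    (z : R[i]) :
  (forall i j, 0 <= M i j) -> 0 <= be ->
  (forall i, \sum_j M i j * (\sum_l M j l) <= al * (\sum_j M i j) + be) ->
  eigenvalue (map_mx (real_complex R) M) z ->
  Normc.normc z ^+ 2 <= al * Normc.normc z + be.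
Proof.
move=> M0 be0 hM /eigenvalueP[v vM v0].
set la := Normc.normc z; have la0 : 0 <= la by apply: normc_ge0.
pose x i := Normc.normc (v 0 i); pose r i := \sum_j M i j.
have x0 i : 0 <= x i by apply: normc_ge0.
have r0 i : 0 <= r i by apply: sumr_ge0.
have hx j : la * x j <= \sum_i x i * M i j.
  rewrite -Normc.normcM.
  have -> : z * v 0 j = \sum_i v 0 i * real_complex R (M i j).
    have := congr1 (fun w : 'rV_m => w 0 j) vM; rewrite !mxE => <-.
    by apply: eq_bigr => i _; rewrite mxE.
  apply: (le_trans (normc_sum _ _ _)); apply: ler_sum => i _.
  by rewrite Normc.normcM normc_nneg.
pose X := \sum_i x i; pose D := \sum_i x i * r i.
have X0 : 0 < X.
  rewrite lt0r sumr_ge0 // andbT psumr_eq0 //; apply: contra v0 => /allP h.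
  apply/eqP/rowP => i; rewrite mxE; apply: Normc.eq0_normc; apply/eqP.
  exact: (h i (mem_index_enum i)).
have XD : la * X <= D.
  rewrite /X mulr_sumr; apply: le_trans (ler_sum _ (fun j _ => hx j)) _.
  by rewrite exchange_big /= ler_sum // => i _; rewrite mulr_sumr.
have DD : la * D <= al * D + be * X.
  have -> : la * D = \sum_j (la * x j) * r j.
    by rewrite mulr_sumr; apply: eq_bigr => j _; rewrite mulrA.
  apply: (@le_trans _ _ (\sum_j (\sum_i x i * M i j) * r j)).
    by apply: ler_sum => j _; rewrite ler_wpM2r.
  rewrite mulr_sumr mulr_sumr -big_split /=.
  under eq_bigr => j _ do rewrite mulr_suml.
  rewrite exchange_big /=; apply: ler_sum => i _.
  have := ler_wpM2l (x0 i) (hM i); rewrite -/(r i) mulr_sumr => h.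
  under eq_bigr => j _ do rewrite -mulrA.
  lra.
(* For |z| <= al the claim is immediate; otherwise D >= |z| X may be used in
   (|z| - al) D <= be X. *)
rewrite -(ler_pM2r X0); have beX : 0 <= be * X by rewrite mulr_ge0 // ltW.
case: (leP la al) => hl.
  have : 0 <= (al - la) * (la * X) by rewrite !mulr_ge0 ?subr_ge0 // ltW.
  lra.
have : 0 <= (la - al) * (D - la * X) by rewrite mulr_ge0 ?subr_ge0 // ltW.
lra.
Qed.

(** The supremum of the empty set is 0, whence the condition on the sign of B. *)
Lemma spectral_radius_le (R : realType) (m : nat) (M : 'M[R]_m) (B : R) :
  0 <= B ->
  (forall z : R[i], eigenvalue (map_mx (real_complex R) M) z ->
     Normc.normc z <= B) ->
  spectral_radius M <= B.
Proof.
move=> B0 hB; rewrite /spectral_radius.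
have [ne0|h0] := pselect (eigenvalue_moduli M !=set0)%classic.
  by apply: ge_sup => // _ [z hz <-]; exact: hB.
by rewrite sup_out // => -[].
Qed.

(** * Spectral radius and codegrees in graphs *)

Definition nbhd {G : sgraph} (v : G) : {set G} := [set w | adj v w].

Lemma sum_adjmx (R : realType) (G : sgraph) (i : 'I_(Defs.order G)) (f : G -> R) :
  \sum_j adjmx R G i j * f (enum_val j) = \sum_(w in nbhd (enum_val i)) f w.
Proof.
rewrite [RHS]big_mkcond /= [RHS](reindex _ (onW_bij _ (enum_val_bij G))) /=.
apply: eq_bigr => j _; rewrite mxE inE.
by case: ifP => _; rewrite ?mul1r ?mul0r.
Qed.

(** The coefficient al + 1 accounts for the closed walks u - w - u, which
    number |nbhd u|.  The hypothesis that the graph has a vertex holds as soon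
    as there is an eigenvalue; it matters for bounds that involve n - 1. *)
Lemma spectral_radius_codegree (R : realType) (G : sgraph) (al be B : R) :
  0 <= be -> 0 <= B ->
  (forall u : G,
     \sum_(v in [set~ u]) #|nbhd v :&: nbhd u|%:R <= al * #|nbhd u|%:R + be) ->
  (forall x, (0 < Defs.order G)%N -> 0 <= x ->
     x ^+ 2 <= (al + 1) * x + be -> x <= B) ->
  spectral_radius (adjmx R G) <= B.
Proof.
move=> be0 B0 hcod hB; apply: spectral_radius_le => // z hz.
have n0 : (0 < Defs.order G)%N.
  case/eigenvalueP: hz => v _; rewrite lt0n; apply: contra_neqN => /eqP n0.
  by apply/rowP => i; exfalso; have := ltn_ord i; rewrite {2}n0.
apply: hB n0 (normc_ge0 _ _) _; apply: eigenvalue_sqr_le hz => // [i j|i].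
  by rewrite mxE ler0n.
have deg (j : 'I_(Defs.order G)) :
    \sum_l adjmx R G j l = #|nbhd (enum_val j : G)|%:R.
  under eq_bigr => l _ do rewrite -[adjmx R G j l]mulr1.
  by rewrite (@sum_adjmx R G j (fun=> 1)) sumr_const.
under eq_bigr => j _ do rewrite deg.
rewrite deg (@sum_adjmx R G i (fun w => #|nbhd w|%:R)); set u := enum_val i.
have -> : \sum_(w in nbhd u) #|nbhd w|%:R = \sum_v #|nbhd v :&: nbhd u|%:R :> R.
  rewrite -!natr_sum; congr (_%:R); symmetry.
  have := @sum_degrees _ _ (@nbhd G) setT (nbhd u).
  rewrite (eq_bigl xpredT) => [->|v]; last by rewrite inE.
  apply: eq_bigr => w _.
  by apply/eq_card => v; rewrite !inE adj_sym.
rewrite (bigD1 u) //= setIid.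
have := hcod u; rewrite (eq_bigl (fun v => v != u)) => [h|v]; last by rewrite !inE.
by rewrite mulrDl mul1r; lra.
Qed.

(** Since no vertex is adjacent to itself, common neighbours of S lie outside
    S, so s of them would span a K_{s,t} with S. *)
Lemma Kfree_common_nbhd (s t : nat) (G : sgraph) (S : {set G}) :
  Kfree s t G -> #|S| = t -> (#|[set v | S \subset nbhd v]| < s)%N.
Proof.
move=> hfree St; rewrite ltnNge; apply/negP => hs; apply: hfree.
set C := [set v | _] in hs.
have SC x y : x \in C -> y \in S -> adj x y.
  by rewrite inE => /subsetP h /h; rewrite inE.
pose f (x : Kbip s t) : G := match x with
  | inl i => enum_val (widen_ord hs i)
  | inr j => enum_val (cast_ord (esym St) j) end.
have fC i : f (inl i) \in C by apply: enum_valP.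
have fS j : f (inr j) \in S by apply: enum_valP.
have ne i j : f (inl i) <> f (inr j).
  by move=> e; have := SC _ _ (fC i) (fS j); rewrite e adj_irr.
exists f; split; last first.
  case=> [i|j] [i'|j'] // _; first exact: SC (fC i) (fS j').
  by rewrite adj_sym; exact: SC (fC i') (fS j).
case=> [i|j] [i'|j'] e; [|by case: (ne _ _ e)|by case: (ne _ _ (esym e))|].
  by congr inl; apply/val_inj; have /(congr1 val) := enum_val_inj e.
by congr inr; apply/val_inj; have /(congr1 val) := enum_val_inj e.
Qed.

(** * The two bounds *)

Lemma spectral_bound_Ks2 (R : realType) (s : nat) (G : sgraph) :
  (2 <= s)%N -> Kfree s 2 G ->
  spectral_radius (adjmx R G)
    <= 1 / 2 + Num.sqrt ((s%:R - 1) * ((Defs.order G)%:R - 1) + 1 / 4).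
Proof.
move=> s2 hfree; set n := Defs.order G.
have s1 : 0 <= s%:R - 1 :> R by rewrite subr_ge0 ler1n ltnW.
apply: (@spectral_radius_codegree _ _ 0 ((s%:R - 1) * n.-1%:R)).
- by rewrite mulr_ge0.
- by rewrite addr_ge0 ?sqrtr_ge0.
- move=> u; rewrite mul0r add0r.
  apply: (@le_trans _ _ (\sum_(v in [set~ u]) (s%:R - 1 : R))).
    apply: ler_sum => v; rewrite !inE => vu.
    have := Kfree_common_nbhd s 2 G [set v; u] hfree; rewrite cards2 vu => /(_ erefl).
    rewrite lerBrDr natr1 ler_nat; apply: leq_trans.
    apply/subset_leq_card/subsetP => w; rewrite !inE => /andP[vw uw].
    by rewrite subUset !sub1set !inE ![adj w _]adj_sym vw.
  by rewrite sumr_const cardsC1 mulr_natr.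
- move=> x n0 x0 hx.
  have sq0 := sqrtr_ge0 ((s%:R - 1) * (n%:R - 1) + 1 / 4 : R).
  (* Complete the square: (x - 1/2)^2 = x^2 - x + 1/4. *)
  have [hx2|hx2] := leP x (1 / 2); first by lra.
  suff: x - 1 / 2 <= Num.sqrt ((s%:R - 1) * (n%:R - 1) + 1 / 4) by lra.
  rewrite -[leLHS]ger0_norm -?sqrtr_sqr; last lra.
  have nE : n%:R = n.-1%:R + 1 :> R by rewrite natr1 prednK.
  by apply: ler_wsqrtr; rewrite nE; move: (n.-1%:R : R) hx => m hx; nra.
Qed.

(** The case t >= 3, with the roots a and b given.  For q = s - t + 1 and
    k = t - 3, the sum q + k = s - 2 is the number of vertices other than u that
    may be adjacent to t given neighbours of u. *)
Lemma spectral_bound_Kst (R : realType) (s t : nat) (G : sgraph) (a b : R) :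
  (3 <= t)%N -> (t <= s)%N -> Kfree s t G ->
  0 <= a -> a ^+ t = (Defs.order G)%:R ->
  0 <= b -> b ^+ t = s%:R - t%:R + 1 ->
  spectral_radius (adjmx R G)
    <= b * a ^+ t.-1 + (t%:R - 1) * a ^+ t.-2 + t%:R - 2.
Proof.
case: t => [|[|[|k]]] // _ ts hfree a0 an b0 bs.
have b1 : 1 <= b.
  rewrite -(@ler_pXn2r _ k.+3) ?nnegrE // expr1n bs lerDr subr_ge0 ler_nat //.
have -> : b * a ^+ k.+3.-1 + (k.+3%:R - 1) * a ^+ k.+3.-2 + k.+3%:R - 2
   = (b * a ^+ k.+2 + k.+1%:R) + k.+2%:R * a ^+ k.+1.
  by rewrite /= -!natr1; ring.
have ba0 : 0 <= b * a ^+ k.+2 by rewrite mulr_ge0 ?exprn_ge0.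
have Q0 : 0 <= k.+2%:R * a ^+ k.+1 by apply: mulr_ge0; rewrite ?exprn_ge0.
apply: (@spectral_radius_codegree _ _ (b * a ^+ k.+2 + k%:R)
          (k.+2%:R * a ^+ (k.+3 + k))).
- by apply: mulr_ge0; rewrite ?exprn_ge0.
- by do 2 ?apply: addr_ge0.
- move=> u; apply: (@zarankiewicz _ _ _ _ _ _ (s - k.+3).+1) => //.
  + by rewrite bs -natr1 natrB.
  + by rewrite an ler_nat max_card.
  + move=> S Su St; have := Kfree_common_nbhd _ _ _ S hfree St.
    rewrite (cardsD1 u) inE Su add1n => hs.
    have sE : (s = (s - k.+3).+1 + k + 2)%N.
      by rewrite -[LHS](subnK ts) !addnS addSn addn0.
    move: hs; rewrite [leqRHS]sE addn2 !ltnS; apply: leq_trans.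
    by apply/subset_leq_card/subsetP => v; rewrite !inE.
- move=> x _ x0 hx; apply: (@le_of_sqr_le _ _ _ _ (a ^+ k.+2)).
  + by rewrite exprn_ge0.
  + rewrite -[leLHS]mul1r -[leLHS]addr0 lerD // ler_wpM2r ?exprn_ge0 //.
  + exact: Q0.
  + move: hx; rewrite -addrA natr1 -mulrA -exprD.
    by rewrite (_ : k.+3 + k = k.+1 + k.+2)%N // !addSn !addnS.
Qed.

Theorem theorem1 (R : realType) (s t : nat) (hts : (t <= s)%N) (ht : (2 <= t)%N)
    (G : sgraph) (n : nat) (mu : R)
    (hfree : Kfree s t G)
    (hn : Defs.order G = n)
    (hmu : spectral_radius (adjmx R G) = mu) :
  (t = 2%N ->
     mu <= 1 / 2 + Num.sqrt ((s%:R - 1) * (n%:R - 1) + 1 / 4)) /\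
  ((3 <= t)%N ->
     mu <= (s%:R - t%:R + 1) `^ (1 / t%:R) * n%:R `^ (1 - 1 / t%:R)
           + (t%:R - 1) * n%:R `^ (1 - 2 / t%:R) + t%:R - 2).
Proof.
rewrite -hmu -hn; split=> [t2|t3].
  by apply: spectral_bound_Ks2; rewrite -t2.
have t0 : t%:R != 0 :> R by rewrite pnatr_eq0 -lt0n (leq_trans _ ht).
have rootK (x : R) : 0 <= x -> (x `^ (1 / t%:R)) ^+ t = x.
  by move=> x0; rewrite -powR_mulrn ?powR_ge0 // -powRrM mulfVK // powRr1.
have powE i : (i <= t)%N -> ((Defs.order G)%:R `^ (1 - i%:R / t%:R)
    = ((Defs.order G)%:R `^ (1 / t%:R)) ^+ (t - i) :> R).
  move=> it; rewrite -powR_mulrn ?powR_ge0 // -powRrM natrB //.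
  by congr (_ `^ _); field.
rewrite (powE 2%N ht) (powE 1%N (ltnW ht)) subn1 subn2.
apply: (@spectral_bound_Kst R s) => //; rewrite ?powR_ge0 ?rootK //.
by rewrite addr_ge0 // subr_ge0 ler_nat.
Qed.
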